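(* Let $G$ be a disjoint union of circuits such that at most one of the circuits has odd length, or such that all circuits of odd length have exactly $3$ vertices. Then $G$ has a graceful difference labeling, unless $G=\overrightarrow{C_3}$ or $G=\overrightarrow{C_2}+\overrightarrow{C_3}$.
   Context: Directed graphs are finite. A graceful difference labeling (gdl) of a directed graph $G=(V,A)$ is a bijection $f:V\rightarrow\{1,\ldots,|V|\}$ such that, when each arc $uv\in A$ (from $u$ to $v$) is assigned the difference label $f(v)-f(u)$, the resulting arc labels are pairwise distinct. For $k\ge 2$, the circuit $\overrightarrow{C_k}$ is the directed graph with vertex set $\{v_1,\ldots,v_k\}$ and arc set $\{v_iv_{i+1}: 1\le i<k\}\cup\{v_kv_1\}$; its length is $k$ (so $\overrightarrow{C_2}$ consists of two opposite arcs between two vertices). A circuit means a directed graph isomorphic to some $\overrightarrow{C_k}$ with $k\ge 2$. For vertex-disjoint directed graphs $G_i=(V_i,A_i)$ and $G_j=(V_j,A_j)$, the disjoint union $G_i+G_j$ is the directed graph with vertex set $V_i\cup V_j$ and arc set $A_i\cup A_j$. Graphs are identified up to isomorphism. *)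

(* Defs.v *)
From mathcomp Require Import all_boot all_order all_algebra.

Set Implicit Arguments.
Unset Strict Implicit.
Unset Printing Implicit Defensive.

Import GRing.Theory.

Record digraph := Digraph { vertex :> finType; arc : rel vertex }.

Definition isomorphic (G H : digraph) : Prop :=
  exists2 h : G -> H, bijective h & forall u v, arc (h u) (h v) = arc u v.

(* The vertex v_i of the circuit is the ordinal of value i - 1. Only k >= 2 is
   meaningful: for k = 1 this is a loop. *)
Definition circuit (k : nat) : digraph :=
  @Digraph 'I_k (fun i j => (j == i.+1 :> nat) || (i.+1 == k) && (j == 0 :> nat)).

Definition djunion_arc (G H : digraph) : rel (G + H) :=
  fun x y => match x, y with
             | inl u, inl v => arc u v
             | inr u, inr v => arc u v
             | _, _ => false
             end.

Definition djunion (G H : digraph) : digraph :=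
  @Digraph (G + H)%type (@djunion_arc G H).

Definition empty_digraph : digraph := @Digraph void (fun _ _ => false).

Definition circuits (ks : seq nat) : digraph :=
  foldr (fun k G => djunion (circuit k) G) empty_digraph ks.

Definition graceful_difference_labeling (G : digraph) (f : G -> nat) : Prop :=
  [/\ injective f,
      forall n, (exists v, f v = n) <-> 1 <= n <= #|vertex G|
    & forall u v u' v' : G, arc u v -> arc u' v' ->
        ((f v)%:Z - (f u)%:Z = (f v')%:Z - (f u')%:Z)%R -> (u, v) = (u', v')].

Definition has_gdl (G : digraph) : Prop :=
  exists f : G -> nat, graceful_difference_labeling f.

(* Main.v *)
(* A circuit is written as the cyclic list of its labels, shifted to 0..n-1.
   Once the arcs of an inner part with n vertices use differences of absolute
   value below n, circuits can be wrapped around it: give them the p smallest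
   and the r largest labels; every arc between the two ends has a difference of
   absolute value above n, with the sign telling its direction, so only the few
   short arcs inside one end may conflict with the inner part. Circuits of even
   length 2 or at least 6, and pairs of C_4, alternate between the two ends and
   need no short arc at all; a C_3 needs one short difference and a C_4 two.
   It remains to label the inner parts: no odd circuit, one odd circuit (a
   zigzag), or m triangles. For m = 6n there is an explicit family whose
   differences all have absolute value at least 2n, which leaves room for up to
   five more triangles and for a C_4. *)

From mathcomp Require Import all_boot all_order all_algebra.
From mathcomp Require Import zify.
Require Import Defs.

Set Implicit Arguments.
Unset Strict Implicit.
Unset Printing Implicit Defensive.

Import Order.TTheory GRing.Theory Num.Theory.

Local Open Scope ring_scope.

(** * Differences along cyclic lists *)

Definition diffs (V : zmodType) (c : seq V) : seq V :=
  [seq p.2 - p.1 | p <- zip c (rot 1 c)].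

Definition labels (V : zmodType) (cs : seq (seq V)) : seq V := flatten cs.

Definition arc_labels (V : zmodType) (cs : seq (seq V)) : seq V :=
  flatten (map (@diffs V) cs).

Lemma size_diffs (V : zmodType) (c : seq V) : size (diffs c) = size c.
Proof. by rewrite size_map size_zip size_rot minnn. Qed.

Lemma nth_rot1 (T : Type) (x : T) (c : seq T) i : (i < size c)%N ->
  nth x (rot 1 c) i = nth x c (if i.+1 == size c then 0 else i.+1).
Proof.
case: c => [|a c] // lt_i; rewrite rot1_cons nth_rcons /=.
by move: lt_i; rewrite /= eqSS ltnS; case: (ltngtP i (size c)).
Qed.

Lemma nth_diffs (V : zmodType) (c : seq V) i : (i < size c)%N ->
  nth 0 (diffs c) i
  = nth 0 c (if i.+1 == size c then 0 else i.+1) - nth 0 c i.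
Proof.
move=> lt_i; rewrite (nth_map (0, 0)) ?size_zip ?size_rot ?minnn //.
by rewrite nth_zip ?size_rot //= nth_rot1.
Qed.

Lemma diffs_mkseq (V : zmodType) (g : nat -> V) n :
  diffs (mkseq g n)
  = mkseq (fun i => g (if i.+1 == n then 0 else i.+1) - g i) n.
Proof.
apply: (@eq_from_nth _ 0); rewrite size_diffs !size_mkseq // => i lt_i.
rewrite nth_diffs size_mkseq // !nth_mkseq //.
by case: eqP => // ne_i; lia.
Qed.

Lemma diffs_map (V W : zmodType) (phi : V -> W) (psi : V -> W) :
  (forall x y, phi x - phi y = psi (x - y)) ->
  forall c, diffs (map phi c) = map psi (diffs c).
Proof.
move=> phiB c; rewrite /diffs -map_rot -map_comp.
by elim: c (rot 1 c) => [|x c IHc] [|y c'] //=; rewrite phiB IHc.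
Qed.

Lemma mem_diffs (V : zmodType) (c : seq V) d : d \in diffs c ->
  exists x y, [/\ x \in c, y \in c & d = y - x].
Proof.
move=> /(nthP 0)[i]; rewrite size_diffs => lt_i <-; rewrite nth_diffs //.
exists (nth 0 c i), (nth 0 c (if i.+1 == size c then 0 else i.+1)).
split=> //; apply: mem_nth => //; case: eqP => [_|/eqP ne_i].
  exact: leq_ltn_trans lt_i.
by rewrite ltn_neqAle ne_i.
Qed.

(* [F] is a set of differences that the labelling leaves unused. *)
Definition labelable (ks : seq nat) (F : seq int) : Prop :=
  exists cs : seq (seq int),
    [/\ perm_eq (map size cs) ks,
        all (fun x => 0 <= x < (sumn ks)%:Z) (labels cs),
        uniq (labels cs), uniq (arc_labels cs)
      & ~~ has (mem F) (arc_labels cs)].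

Lemma labelable_perm ks ks' F :
  perm_eq ks ks' -> labelable ks F -> labelable ks' F.
Proof.
move=> pk [cs [h1 h2 h3 h4 h5]]; exists cs; split=> //.
  exact: perm_trans h1 pk.
by rewrite -(perm_sumn pk).
Qed.

Lemma labelable_sub ks F F' :
  {subset F' <= F} -> labelable ks F -> labelable ks F'.
Proof.
move=> sF [cs [h1 h2 h3 h4 h5]]; exists cs; split=> //.
by apply: contra h5 => /hasP[x xcs xF]; apply/hasP; exists x => //; apply: sF.
Qed.

(* In the pattern P, the pair (0, x) stands for the low label x < p, and (1, x)
   for the high label n + p + x, x < r, when P is wrapped around n labels; [S]
   lists the differences of the short arcs. *)
Definition layer_ok (P : seq (seq (int * int))) (p r : nat) (S F : seq int) :=
  [&& sumn (map size P) == (p + r)%N,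
      all (fun u => (u.1 == 0) && (0 <= u.2 < p%:Z)
                 || (u.1 == 1) && (0 <= u.2 < r%:Z)) (labels P),
      uniq (labels P), uniq (arc_labels P)
    & all (fun d => (d.1 == 0) ==> (d.2 \in S) && (d.2 \notin F)) (arc_labels P)].

Lemma mem_labels (V : zmodType) (cs : seq (seq V)) c x :
  c \in cs -> x \in c -> x \in labels cs.
Proof. by move=> ? ?; apply/flattenP; exists c. Qed.

Lemma mem_arc_labels (V : zmodType) (cs : seq (seq V)) d : d \in arc_labels cs ->
  exists x y, [/\ x \in labels cs, y \in labels cs & d = y - x].
Proof.
move=> /flattenP[_ /mapP[c c_cs ->]] /mem_diffs[x [y [xc yc ->]]].
by exists x, y; split=> //; apply: mem_labels c_cs _.
Qed.

Lemma labels_map (V W : zmodType) (phi : V -> W) cs :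
  labels (map (map phi) cs) = map phi (labels cs).
Proof. by rewrite /labels map_flatten. Qed.

Lemma arc_labels_map (V W : zmodType) (phi psi : V -> W) cs :
  (forall x y, phi x - phi y = psi (x - y)) ->
  arc_labels (map (map phi) cs) = map psi (arc_labels cs).
Proof.
move=> phiB; rewrite /arc_labels map_flatten -!map_comp.
by congr flatten; apply: eq_map => c /=; apply: diffs_map.
Qed.

Lemma labels_cat (V : zmodType) (cs cs' : seq (seq V)) :
  labels (cs ++ cs') = labels cs ++ labels cs'.
Proof. exact: flatten_cat. Qed.

Lemma arc_labels_cat (V : zmodType) (cs cs' : seq (seq V)) :
  arc_labels (cs ++ cs') = arc_labels cs ++ arc_labels cs'.
Proof. by rewrite /arc_labels map_cat flatten_cat. Qed.

(** Both [phi] and [tau] respect differences: [phi] carries those of [P] along and [tau], a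
    translation, keeps the inner ones. A long arc gets [n + p + x] with [x > - p], or
    [- (n + p) + x] with [x < p], so its absolute value exceeds [n]; inner differences stay below
    [n], and [F] within [n]. A short arc takes a value of [S], hence of [F], which the inner part
    avoids. *)
Lemma labelable_layer P p r S F F' ks :
    layer_ok P p r S F' -> labelable ks F ->
    {subset S <= F} -> {subset F' <= F} ->
    (forall d, d \in F -> `|d| <= (sumn ks)%:Z) ->
  labelable (map size P ++ ks) F'.
Proof.
move=> /and5P[/eqP sP /allP inP uP aP /allP shortP].
move=> [cs [pcs /allP incs ucs acs /hasPn Fcs]] sSF sF'F boundF.
set n := sumn ks in incs boundF.
pose M : int := (n + p)%:Z.
pose phi (u : int * int) : int := u.2 + u.1 * M.
pose tau (x : int) : int := x + p%:Z.
have phiB x y : phi x - phi y = phi (x - y) by rewrite /phi /=; lia.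
have tauB x y : tau x - tau y = id (x - y) by rewrite /tau /=; lia.
have labP (b x : int) : (b, x) \in labels P ->
    (b = 0 /\ 0 <= x < p%:Z) \/ (b = 1 /\ 0 <= x < r%:Z).
  by move=> /inP /orP[] /andP[/eqP]; [left|right].
have labcs (x : int) : x \in labels cs -> 0 <= x < n%:Z by move=> /incs.
have arcP (b x : int) : (b, x) \in arc_labels P ->
    [\/ b = 0, b = 1 /\ - p%:Z < x | b = -1 /\ x < p%:Z].
  move=> /mem_arc_labels[[c y] [[c' z] [/labP yP /labP zP [-> ->]]]].
  case: yP => -[-> ?]; case: zP => -[-> ?];
    [constructor 1|constructor 2|constructor 3|constructor 1]; lia.
have arccs (d : int) : d \in arc_labels cs -> `|d| < n%:Z.
  by move=> /mem_arc_labels[x [y [/labcs ? /labcs ? ->]]]; lia.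
have shortF (b x : int) : (b, x) \in arc_labels P -> b = 0 ->
    [/\ x \in F, x \notin F' & `|x| <= n%:Z].
  by move=> /shortP/implyP dP /eqP/dP/andP[/sSF /[dup] /boundF].
exists (map (map phi) P ++ map (map tau) cs).
rewrite labels_cat arc_labels_cat !labels_map !(arc_labels_map _ phiB).
rewrite (@arc_labels_map _ _ tau id _ tauB) map_id map_cat -!map_comp.
rewrite (eq_map (_ : size \o map phi =1 size)); last by move=> c /=; rewrite size_map.
rewrite (eq_map (_ : size \o map tau =1 size)); last by move=> c /=; rewrite size_map.
have sumE : (sumn (map size P ++ ks) = p + r + n)%N by rewrite sumn_cat sP.
split.
- by rewrite perm_cat2l.
- rewrite all_cat sumE; apply/andP; split; apply/allP => x /mapP[].
    by move=> [b y] /labP; rewrite /phi /M /= => -[] [-> ?] ->; lia.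
  by move=> y /labcs; rewrite /tau => ? ->; lia.
- rewrite cat_uniq (map_inj_in_uniq (f := phi)); last first.
    move=> [b x] [b' y] /labP xP /labP yP; rewrite /phi /M /=.
    by case: xP yP => -[-> ?] [] [-> ?] /= ?; congr (_, _); lia.
  rewrite uP (map_inj_in_uniq (f := tau)) ?ucs ?andbT; last first.
    by rewrite /tau => x y _ _ ?; lia.
  apply/hasPn => _ /mapP[x /labcs xcs ->]; apply/mapP => -[[b y] /labP].
  by move: xcs; rewrite /tau /phi /M /= => ? [] [-> ?]; lia.
- rewrite cat_uniq acs andbT map_inj_in_uniq ?aP /=.
    apply/hasPn => d /[dup] /arccs ? /Fcs /negP dF.
    apply/mapP => -[[b x] xP]; rewrite /phi /M /= => dE.
    case: (arcP b x xP) => [b0|[b0 ?]|[b0 ?]]; subst b; try lia.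
    have [xF _ _] := shortF _ _ xP erefl.
    by apply: dF; rewrite dE mul0r addr0.
  move=> [b x] [b' y] xP yP.
  have bx : b = 0 -> `|x| <= n%:Z by move=> /(shortF _ _ xP)[].
  have by' : b' = 0 -> `|y| <= n%:Z by move=> /(shortF _ _ yP)[].
  move: bx by'; rewrite /phi /M /=.
  case: (arcP b x xP) => [?|[? ?]|[? ?]]; case: (arcP b' y yP) => [?|[? ?]|[? ?]];
    subst b b' => bx by' ?; try (congr (_, _)); lia.
- rewrite has_cat negb_or; apply/andP; split; apply/hasPn.
    move=> _ /mapP[[b x] xP ->]; apply/negP => /= uF.
    have := boundF _ (sF'F _ uF); move: uF; rewrite /phi /M /=.
    case: (arcP b x xP) => [?|[? ?]|[? ?]]; subst b; try lia.
    have [_ /negP nF _] := shortF _ _ xP erefl.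
    by rewrite mul0r addr0 => /nF.
  by move=> d dcs; apply: contra (Fcs d dcs); apply: sF'F.
Qed.

(** * Labelled circuits as digraphs *)

Lemma perm_map_lift (T : Type) (x : T) (f : T -> nat) (s : seq T) t :
  perm_eq (map f s) t ->
  exists2 r, perm_eq r (iota 0 (size s)) & map f (map (nth x s) r) = t.
Proof.
rewrite perm_sym => /(perm_iotaP 0)[r pr ->].
rewrite size_map in pr; exists r => //.
rewrite -map_comp; apply/eq_in_map => i.
rewrite (perm_mem pr) mem_iota => /andP[_ ?].
by rewrite /= (nth_map x).
Qed.

(** The type [circuits ks] depends on the order of [ks], while [labelable] fixes the lengths only up
    to permutation; the lists are reordered accordingly. *)
Lemma labelable_seq ks F : labelable ks F ->
  exists cs : seq (seq int),
    [/\ map size cs = ks,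
        all (fun x => 0 <= x < (sumn ks)%:Z) (labels cs),
        uniq (labels cs) & uniq (arc_labels cs)].
Proof.
move=> [cs [/(perm_map_lift [::])[r pr <-] Rcs ucs acs _]].
set cs' := map _ r; have pcs : perm_eq cs' cs.
  by rewrite -[X in perm_eq _ X](mkseq_nth [::]) perm_map.
exists cs'; split=> //.
- by apply/allP => x; rewrite (perm_mem (perm_flatten pcs)) => /(allP Rcs).
- exact: etrans (perm_uniq (perm_flatten pcs)) ucs.
- exact: etrans (perm_uniq (perm_flatten (perm_map _ pcs))) acs.
Qed.

(** Indexing the domain by [map size cs] makes it unfold to a nested sum along [cs]. The default 0
    is never reached, since [i] is below [size c]. *)
Fixpoint circuits_label (cs : seq (seq int)) : circuits (map size cs) -> int :=
  match cs return circuits (map size cs) -> int with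
  | [::] => fun v => match v with end
  | c :: cs' => fun v => match v with
                         | inl i => nth 0 c i
                         | inr w => circuits_label w
                         end
  end.

Lemma circuits_label_mem cs (v : circuits (map size cs)) :
  circuits_label v \in labels cs.
Proof.
elim: cs v => [|c cs IHcs] [] //= v; rewrite /labels /= mem_cat.
  by rewrite mem_nth.
by rewrite IHcs orbT.
Qed.

Lemma circuits_label_inj cs :
  uniq (labels cs) -> injective (@circuits_label cs).
Proof.
elim: cs => [|c cs IHcs] /=; first by move=> _ [].
rewrite cat_uniq => /and3P[uc /hasPn disj ucs] [i|v] [j|w] /= E.
- by move/eqP: E; rewrite nth_uniq // => /eqP/val_inj ->.
- by case/negP: (disj _ (circuits_label_mem w)); rewrite -E mem_nth.
- by case/negP: (disj _ (circuits_label_mem v)); rewrite E mem_nth.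
- by rewrite (IHcs ucs _ _ E).
Qed.

Lemma circuits_label_surj cs x :
  x \in labels cs -> exists v : circuits (map size cs), circuits_label v = x.
Proof.
elim: cs => [|c cs IHcs] //=; rewrite /labels /= mem_cat => /orP[|/IHcs[v <-]].
  by move=> /(nthP 0)[i lt_i <-]; exists (inl (Ordinal lt_i)).
by exists (inr v).
Qed.

Lemma circuit_arcE k (i j : circuit k) :
  arc i j -> nat_of_ord j = if (nat_of_ord i).+1 == k then 0%N else (nat_of_ord i).+1.
Proof.
move=> /= /orP[/eqP ji|/andP[-> /eqP //]].
case: eqP => // ik; have := ltn_ord j; rewrite ji ik ltnn //.
Qed.

Lemma circuits_label_arc cs (u v : circuits (map size cs)) :
  arc u v -> circuits_label v - circuits_label u \in arc_labels cs.
Proof.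
elim: cs u v => [[] //|c cs IHcs] [i|u] [j|v] //= uv; rewrite /arc_labels /= mem_cat.
  rewrite (circuit_arcE uv) -nth_diffs // mem_nth // size_diffs //.
by rewrite IHcs ?orbT.
Qed.

(** Within one circuit an arc is determined by the position of its tail; across circuits, uniqueness
    of the concatenation excludes equal differences. *)
Lemma circuits_label_arc_inj cs (u v u' v' : circuits (map size cs)) :
    uniq (arc_labels cs) -> arc u v -> arc u' v' ->
    circuits_label v - circuits_label u = circuits_label v' - circuits_label u' ->
  (u, v) = (u', v').
Proof.
elim: cs u v u' v' => [[] //|c cs IHcs] [i|u] [j|v] // [i'|u'] [j'|v'] //;
  rewrite /arc_labels /= cat_uniq => /and3P[uc /hasPn disj ucs] uv uv'.
- rewrite [X in nth 0 c X - _](circuit_arcE uv).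
  rewrite [X in _ = nth 0 c X - _](circuit_arcE uv').
  rewrite -!nth_diffs // => /eqP; rewrite nth_uniq ?size_diffs // => /eqP/val_inj ii'.
  subst i'; congr (inl _, inl _).
  by apply: val_inj; rewrite /= (circuit_arcE uv) (circuit_arcE uv').
- move=> E; case/negP: (disj _ (circuits_label_arc uv')); rewrite -E /=.
  by rewrite (circuit_arcE uv) -nth_diffs // mem_nth // size_diffs.
- move=> E; case/negP: (disj _ (circuits_label_arc uv)); rewrite E /=.
  by rewrite (circuit_arcE uv') -nth_diffs // mem_nth // size_diffs.
- by move=> /(IHcs _ _ _ _ ucs uv uv')[-> ->].
Qed.

Lemma card_circuits ks : #|vertex (circuits ks)| = sumn ks.
Proof. by elim: ks => [|k ks IHks] /=; rewrite ?card_void // card_sum card_ord IHks. Qed.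

Lemma labelable_has_gdl (G : digraph) ks F :
  isomorphic G (circuits ks) -> labelable ks F -> has_gdl G.
Proof.
move=> [h [h' hK h'K] hA] /labelable_seq[cs [csE /allP Rcs ucs acs]]; subst ks.
(* Labels start at 0 here and at 1 in a gdl; the shift cancels in differences. *)
pose f (v : G) : nat := `|circuits_label (h v)|.+1.
have fE v : (f v)%:Z = circuits_label (h v) + 1.
  have := Rcs _ (circuits_label_mem (h v)); rewrite /f; lia.
have hI := can_inj hK.
have szl : size (labels cs) = sumn (map size cs) by rewrite size_flatten.
have cardG : #|G| = sumn (map size cs).
  by rewrite -card_circuits; apply: bij_eq_card; exists h' => //; exact: hK.
exists f; split.
- move=> u v uv; apply: hI; apply: (circuits_label_inj ucs).
  by apply: (addIr 1); rewrite -!fE uv.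
- move=> n; split=> [[v <-]|].
    by rewrite cardG; have := Rcs _ (circuits_label_mem (h v)); rewrite /f; lia.
  rewrite cardG => nR.
  (* Surjectivity by counting: the labels are distinct and as many as the integers of the range, so
     they fill it. *)
  have sub : {subset labels cs <= [seq i%:Z | i <- iota 0 (size (labels cs))]}.
    move=> x xcs; apply/mapP; exists `|x|%N; last by have := Rcs _ xcs; lia.
    by rewrite mem_iota szl; have := Rcs _ xcs; lia.
  have [eq_mem _] : labels cs =i [seq i%:Z | i <- iota 0 (size (labels cs))]
     /\ True.
    by split=> //; apply: (uniq_min_size ucs sub _).2; rewrite size_map size_iota.
  have : n.-1%:Z \in labels cs.
    rewrite eq_mem mem_map ?mem_iota ?szl; first by lia.
    by move=> ? ? [].
  move=> /circuits_label_surj[v vE]; exists (h' v).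
  by have := fE (h' v); rewrite h'K vE; lia.
- move=> u v u' v' uv uv' E.
  have huv : arc (h u) (h v) by rewrite hA.
  have huv' : arc (h u') (h v') by rewrite hA.
  have E' : circuits_label (h v) - circuits_label (h u)
            = circuits_label (h v') - circuits_label (h u').
    by move: E; rewrite !fE; lia.
  by case: (circuits_label_arc_inj acs huv huv' E') => /hI -> /hI ->.
Qed.

(** * Circuits alternating between the two ends *)

Definition alternate (T : Type) (x y : nat -> T) (i : nat) : T :=
  if odd i then y i./2 else x i./2.

Lemma alternate_double (T : Type) (x y : nat -> T) t : alternate x y t.*2 = x t.
Proof. by rewrite /alternate odd_double doubleK. Qed.

Lemma alternate_doubleS (T : Type) (x y : nat -> T) t : alternate x y t.*2.+1 = y t.
Proof. by rewrite /alternate /= odd_double uphalf_double. Qed.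

Lemma perm_mkseq_double (T : eqType) (f g h : nat -> T) k :
    (forall t, (t < k)%N -> f t.*2 = g t /\ f t.*2.+1 = h t) ->
  perm_eq (mkseq f k.*2) (mkseq g k ++ mkseq h k).
Proof.
elim: k => [|k IHk] // fgh; have [fg fh] := fgh k (ltnSn k).
have /permP IH := IHk (fun t lt_t => fgh t (ltnW lt_t)).
apply/permP => a; rewrite doubleS !mkseqS -!cats1 !count_cat /= IH count_cat fg fh.
lia.
Qed.

Lemma perm_alternate (T : eqType) (x y : nat -> T) k :
  perm_eq (mkseq (alternate x y) k.*2) (mkseq x k ++ mkseq y k).
Proof.
apply: perm_mkseq_double => t _.
by rewrite alternate_double alternate_doubleS.
Qed.

(** Arcs leaving even positions go from [x] to [y], the others back. In the uses below the two
    groups have opposite signs, so distinctness is a matter within each group. *)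
Lemma diffs_alternate (V : zmodType) (x y : nat -> V) k :
  perm_eq (diffs (mkseq (alternate x y) k.*2))
          (mkseq (fun t => y t - x t) k ++
           mkseq (fun t => x (if t.+1 == k then 0 else t.+1)%N - y t) k).
Proof.
rewrite diffs_mkseq; apply: perm_mkseq_double => t lt_t; split.
  by rewrite ifF ?alternate_doubleS ?alternate_double //; lia.
rewrite -doubleS alternate_doubleS (inj_eq double_inj).
by case: eqP => _; rewrite ?alternate_double.
Qed.

Lemma diffs_alternateS (V : zmodType) (x y : nat -> V) k :
  perm_eq (diffs (mkseq (alternate x y) k.*2.+1))
          (mkseq (fun t => y t - x t) k ++
           rcons (mkseq (fun t => x t.+1 - y t) k) (x 0 - x k)).
Proof.
rewrite diffs_mkseq mkseqS -rcons_cat -!cats1 eqxx alternate_double.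
rewrite (_ : alternate x y 0 = x 0%N) // perm_cat2r.
apply: perm_mkseq_double => t lt_t.
do 2!(rewrite ifF; last by lia).
by rewrite -doubleS !alternate_double !alternate_doubleS.
Qed.

(* In the plain zigzag 0, N-1, 1, N-2, ... the closing arc repeats a difference
   for one parity of k; exchanging 0 and 1 repairs it. *)
Definition swap01 (b : bool) (t : nat) : nat :=
  if b then match t with 0 => 1 | 1 => 0 | _ => t end else t.

Lemma swap01_inj b : injective (swap01 b).
Proof. by case: b => [[|[|s]] [|[|t]]|]. Qed.

Lemma swap01_lt b k t : (1 < k)%N -> (t < k)%N -> (swap01 b t < k)%N.
Proof. by case: b t => [[|[|t]]|t] //= ? ?; lia. Qed.

(** For odd [k] the cyclic consecutive sums are the odd numbers 1, 3, ..., 2k-3 and the closing sum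
    k-1, which is even. For even [k] the exchange turns them into 1, 2, 5, 7, ..., 2k-3 with closing
    sum [k], even and different from 2. *)
Lemma swap01_sum_inj k s t : (2 < k)%N -> (s < k)%N -> (t < k)%N ->
    (swap01 (~~ odd k) (if s.+1 == k then 0 else s.+1)
       + swap01 (~~ odd k) s
     = swap01 (~~ odd k) (if t.+1 == k then 0 else t.+1)
       + swap01 (~~ odd k) t)%N ->
  s = t.
Proof.
by case: s => [|[|s]]; case: t => [|[|t]] => k3 sk tk;
  case: (boolP (odd k)) => /= ?; do ?[case: ifP => /eqP ? /=]; lia.
Qed.

Lemma swap01_sum_lt k t : (2 < k)%N -> (t < k)%N ->
  (swap01 (~~ odd k) (if t.+1 == k then 0 else t.+1)
     + swap01 (~~ odd k) t < 2 * k - 2)%N.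
Proof.
by case: t => [|[|t]] => k3 tk;
  case: (boolP (odd k)) => /= ?; do ?[case: ifP => /eqP ? /=]; lia.
Qed.

(** Every arc joins the two ends, so no short difference occurs. Upward differences are injective in
    the value of [swap01]; downward ones are consecutive sums up to a constant. *)
Lemma labelable_even_layer k ks : (2 < k)%N ->
  labelable ks [::] -> labelable (k.*2 :: ks) [::].
Proof.
move=> k3 kslab; pose b := ~~ odd k.
pose x t : int * int := (0, (swap01 b t)%:Z).
pose y t : int * int := (1, k%:Z - 1 - (swap01 b t)%:Z).
pose P := [:: mkseq (alternate x y) k.*2].
suff P_ok : layer_ok P k k [::] [::].
  have := @labelable_layer P k k [::] [::] [::] ks P_ok kslab.
  by rewrite /= size_mkseq; apply.
have labE : perm_eq (labels P) (mkseq x k ++ mkseq y k).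
  by rewrite /labels /= cats0 perm_alternate.
have arcE : perm_eq (arc_labels P)
    (mkseq (fun t => y t - x t) k ++
     mkseq (fun t => x (if t.+1 == k then 0 else t.+1)%N - y t) k).
  by rewrite /arc_labels /= cats0 diffs_alternate.
have sw t := @swap01_lt b k t (ltnW k3).
rewrite /layer_ok; apply/and5P; split.
- by rewrite /= size_mkseq; lia.
- rewrite (perm_all _ labE) all_cat.
  apply/andP; split; apply/allP => _ /mapP[t + ->]; rewrite mem_iota => /sw ? /=; lia.
- rewrite (perm_uniq labE) cat_uniq; apply/and3P; split.
  + by apply/mkseq_uniqP => s t _ _ [/swap01_inj].
  + by apply/hasPn => _ /mapP[t _ ->]; apply/mapP => -[s _].
  + apply/mkseq_uniqP => s t _ _ [E]; apply: (@swap01_inj b); lia.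
- rewrite (perm_uniq arcE) cat_uniq; apply/and3P; split.
  + by apply/mkseq_uniqP => s t _ _ [E]; apply: (@swap01_inj b); lia.
  + by apply/hasPn => _ /mapP[t _ ->]; apply/mapP => -[s _].
  + apply/mkseq_uniqP => s t sk tk [E].
    by apply: (swap01_sum_inj k3 sk tk); rewrite -/b; lia.
- rewrite (perm_all _ arcE) all_cat.
  by apply/andP; split; apply/allP => _ /mapP[t _ ->].
Qed.

Lemma labelable_mkseq (g : nat -> int) n F :
    (forall i, (i < n)%N -> 0 <= g i < n%:Z) -> uniq (mkseq g n) ->
    uniq (diffs (mkseq g n)) -> {in F, forall d, d \notin diffs (mkseq g n)} ->
  labelable [:: n] F.
Proof.
move=> gR ug ud gF; exists [:: mkseq g n].
rewrite /labels /arc_labels /= !cats0 size_mkseq addn0; split=> //.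
- by apply/allP => _ /mapP[i + ->]; rewrite mem_iota => /andP[_ /gR].
- by apply/hasPn => d dg; apply/negP => /gF; rewrite dg.
Qed.

(** The same zigzag without an inner part. Upward differences are positive and, by [swap01_sum_lt],
    downward ones are at most -2; the free -1 lets a triangle be wrapped around. *)
Lemma labelable_even k : (2 < k)%N -> labelable [:: k.*2] [:: -1].
Proof.
move=> k3; pose b := ~~ odd k.
pose x t : int := (swap01 b t)%:Z.
pose y t : int := (2 * k)%:Z - 1 - (swap01 b t)%:Z.
have sw t := @swap01_lt b k t (ltnW k3).
have arcE := diffs_alternate x y k.
apply: (@labelable_mkseq (alternate x y)).
- move=> i ik; have ik2 : (i./2 < k)%N by rewrite ltn_half_double.
  by have := sw _ ik2; rewrite /alternate /x /y; case: odd; lia.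
- rewrite (perm_uniq (perm_alternate x y k)) cat_uniq; apply/and3P; split.
  + by apply/mkseq_uniqP => s t _ _ [/swap01_inj].
  + apply/hasPn => _ /mapP[t + ->]; rewrite mem_iota => /sw tk.
    by apply/mapP => -[s]; rewrite mem_iota => /sw sk; rewrite /x /y; lia.
  + by apply/mkseq_uniqP => s t _ _ E; apply: (@swap01_inj b); rewrite /y in E; lia.
- rewrite (perm_uniq arcE) cat_uniq; apply/and3P; split.
  + apply/mkseq_uniqP => s t _ _ E; apply: (@swap01_inj b).
    by rewrite /x /y in E; lia.
  + apply/hasPn => _ /mapP[t + ->]; rewrite mem_iota => /andP[_ tk].
    apply/mapP => -[s]; rewrite mem_iota => /sw sk.
    by have := swap01_sum_lt k3 tk; rewrite -/b /x /y; lia.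
  + apply/mkseq_uniqP => s t sk tk E.
    by apply: (swap01_sum_inj k3 sk tk); rewrite -/b; rewrite /x /y in E; lia.
- move=> d; rewrite inE => /eqP ->.
  rewrite (perm_mem arcE) mem_cat; apply/norP; split; apply/mapP => -[t];
    rewrite mem_iota => /andP[_ tk].
    by have := sw _ tk; rewrite /x /y; lia.
  by have := swap01_sum_lt k3 tk; rewrite -/b /x /y; lia.
Qed.

(** Upward differences are the even numbers 2, ..., 2j. The downward differences [z] are negative
    and odd, except for 2-2j when [j] is odd and the exchange applies. The closing arc gives -j or
    1-j for [j] even or odd: an even number, different from 2-2j. So 1 never occurs, and [3 < j]
    rules out -2, which leaves room for a C_4. *)
Lemma labelable_odd j F : (1 < j)%N ->
    F = [::] \/ (3 < j)%N /\ F = [:: 1; -2] ->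
  labelable [:: j.*2.+1] F.
Proof.
move=> j2 FE; pose b := odd j.
pose x t : int := (swap01 b t)%:Z.
pose y t : int := (2 * j)%:Z - (swap01 b t)%:Z.
pose z t := x t.+1 - y t.
have xj : x j = j%:Z by rewrite /x; move: j2; case: (j) => [|[|i]] //; case: (b).
have sw t := @swap01_lt b j t j2.
have arcE : perm_eq (diffs (mkseq (alternate x y) j.*2.+1))
    (mkseq (fun t => y t - x t) j ++ rcons (mkseq z j) (x 0%N - j%:Z)).
  by rewrite -xj diffs_alternateS.
have zP t : (t < j)%N -> - (2 * j)%:Z < z t <= -1 /\ z t != x 0%N - j%:Z
    /\ ((2 < j)%N -> z t != -2).
  move=> tj; rewrite /z /x /y /b; case: t tj => [|[|t]] tj;
    by case: (boolP (odd j)) => ? /=; do ?split; lia.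
have zI s t : (s < j)%N -> (t < j)%N -> z s = z t -> s = t.
  move=> sj tj; rewrite /z /x /y /b.
  by case: s sj => [|[|s]] sj; case: t tj => [|[|t]] tj;
    case: (boolP (odd j)) => ? /=; lia.
have x0 : x 0%N = b%:Z by rewrite /x; case: (b).
apply: (@labelable_mkseq (alternate x y)).
- move=> i ik; rewrite /alternate /y.
  case: (boolP (odd i)) => io; last first.
    case: (ltnP i./2 j) => ij; first by have := sw _ ij; rewrite /x; lia.
    by rewrite (_ : i./2 = j) ?xj; lia.
  have ij : (i./2 < j)%N by lia.
  by have := sw _ ij; lia.
- rewrite mkseqS rcons_uniq (perm_uniq (perm_alternate x y j)) alternate_double xj.
  rewrite (perm_mem (perm_alternate x y j)) cat_uniq mem_cat.
  apply/and4P; split.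
  + apply/norP; split; apply/mapP => -[t]; rewrite mem_iota => /sw ?; rewrite /x /y; lia.
  + by apply/mkseq_uniqP => s t _ _ [/swap01_inj].
  + apply/hasPn => _ /mapP[t + ->]; rewrite mem_iota => /sw tk.
    by apply/mapP => -[s]; rewrite mem_iota => /sw sk; rewrite /x /y; lia.
  + by apply/mkseq_uniqP => s t _ _ E; apply: (@swap01_inj b); rewrite /y in E; lia.
- rewrite (perm_uniq arcE) cat_uniq rcons_uniq; apply/and4P; split.
  + apply/mkseq_uniqP => s t _ _ E; apply: (@swap01_inj b).
    by rewrite /x /y in E; lia.
  + apply/hasPn => d; rewrite mem_rcons inE => dP; apply/mapP => -[s].
    rewrite mem_iota => /sw sk dE.
    case/orP: dP => [/eqP|/mapP[t]]; first by move: dE; rewrite x0 /x /y; lia.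
    by rewrite mem_iota => /zP[]; move: dE; rewrite /x /y; lia.
  + by apply/mapP => -[t]; rewrite mem_iota => /zP[_ [/eqP zt _]] /esym.
  + by apply/mkseq_uniqP => s t sk tk /zI; apply.
- case: FE => [->|[j4 ->]] // d d12; rewrite (perm_mem arcE) mem_cat mem_rcons inE.
  have {d12}d12 : d = 1 \/ d = -2.
    by move: d12; rewrite !inE => /orP[] /eqP ->; [left|right].
  rewrite !negb_or; apply/and3P; split.
  + apply/mapP => -[t]; rewrite mem_iota => /sw ?; rewrite /x /y; lia.
  + by rewrite x0 /b; case: d12 => ->; case: (boolP (odd j)); lia.
  + apply/mapP => -[t]; rewrite mem_iota => /zP[? [_ /(_ (ltnW j4)) ?]]; lia.
Qed.

(** * Disjoint unions of triangles *)

Lemma uniq_flatten_map (T U : eqType) (g : T -> seq U) s :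
    uniq s -> (forall i, i \in s -> uniq (g i)) ->
    (forall i j x, i \in s -> j \in s -> x \in g i -> x \in g j -> i = j) ->
  uniq (flatten (map g s)).
Proof.
elim: s => [|i s IHs] //= /andP[is_ us] gu gd.
rewrite cat_uniq gu ?mem_head // IHs ?andbT //; last first.
- by move=> j k x js ks; apply: gd; rewrite inE ?js ?ks orbT.
- by move=> j js; apply: gu; rewrite inE js orbT.
apply/hasPn => x /flatten_mapP[j js xj]; apply/negP => xi.
by move/negP: is_; rewrite (gd i j x) ?mem_head // inE js orbT.
Qed.

Lemma labels_flatten (V : zmodType) (css : seq (seq (seq V))) :
  labels (flatten css) = flatten (map (@labels V) css).
Proof. by elim: css => //= cs css IHcss; rewrite labels_cat IHcss. Qed.

Lemma arc_labels_flatten (V : zmodType) (css : seq (seq (seq V))) :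
  arc_labels (flatten css) = flatten (map (@arc_labels V) css).
Proof. by elim: css => //= cs css IHcss; rewrite arc_labels_cat IHcss. Qed.

Definition mirror (N : nat) (x : int) : int := N%:Z - 1 - x.

Lemma uniq_map_inj (T U : eqType) (f : T -> U) s :
  uniq (map f s) -> {in s &, injective f}.
Proof.
move=> us x y xs ys fxy; rewrite -(nth_index x xs) -[RHS](nth_index x ys).
congr nth; apply/eqP; rewrite -(nth_uniq (f x) _ _ us) ?size_map ?index_mem //.
by rewrite !(nth_map x) ?index_mem // !nth_index // fxy.
Qed.

(** If [m x] were in [s], having the key of [x] it would equal [x]. The keys used are the distance
    to the centre, for labels, and the absolute value, for differences. *)
Lemma uniq_cat_map_key (T U : eqType) (m : T -> T) (key : T -> U) s :
    injective m -> (forall x, key (m x) = key x) -> {in s, forall x, m x != x} ->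
  uniq (map key s) -> uniq (s ++ map m s).
Proof.
move=> mI keym fix0 us; have us' := map_uniq us.
rewrite cat_uniq us' map_inj_uniq // us' andbT.
apply/hasPn => _ /mapP[x xs ->]; apply/negP => mxs.
have mxx : m x = x by apply: (uniq_map_inj us) => //; rewrite keym.
by case/eqP: (fix0 x xs).
Qed.

(* Reflecting a circuit negates its differences, so it is enough that those of
   [cs] have distinct absolute values, and that its labels have distinct
   distances to the centre. *)
Lemma labelable_mirror cs ks F (N := sumn (map size cs)) :
    perm_eq (map size cs ++ map size cs) ks ->
    all (fun x => 0 <= x < (N.*2)%:Z) (labels cs) ->
    uniq (map (fun x : int => absz (x *+ 2 + 1 - (N.*2)%:Z)%R) (labels cs)) ->
    0 \notin arc_labels cs -> uniq (map absz (arc_labels cs)) ->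
    all (fun d => (d \notin F) && (- d \notin F)) (arc_labels cs) ->
  labelable ks F.
Proof.
move=> pks /allP Rcs ucs cs0 acs /allP Fcs.
have sumks : sumn ks = N.*2 by rewrite -(perm_sumn pks) sumn_cat addnn.
have mB x y : mirror N.*2 x - mirror N.*2 y = - (x - y) by rewrite /mirror; lia.
exists (cs ++ map (map (mirror N.*2)) cs).
rewrite labels_cat arc_labels_cat labels_map (arc_labels_map _ mB).
split.
- rewrite map_cat -map_comp (eq_map (_ : _ =1 size)) // => c.
  by rewrite /= size_map.
- rewrite sumks all_cat; apply/andP; split; first exact/allP.
  by apply/allP => _ /mapP[x /Rcs xR ->]; move: xR; rewrite /mirror; lia.
(* The key is twice the distance from [x] to the centre N - 1/2; it is odd, so the reflection fixes
   no label. *)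
- apply: uniq_cat_map_key ucs.
  + by rewrite /mirror => x y; lia.
  + by rewrite /mirror => x; lia.
  + by rewrite /mirror => x _; lia.
- apply: uniq_cat_map_key acs; [exact: oppr_inj|exact: abszN|].
  move=> d dcs; apply/eqP => dd; move/negP: cs0; apply.
  by rewrite (_ : 0 = d) //; lia.
- rewrite has_cat negb_or; apply/andP; split; apply/hasPn.
    by move=> d /Fcs /andP[].
  by move=> _ /mapP[d /Fcs /andP[_ ?] ->].
Qed.

(* Found by a computer search among arithmetic progressions. Together with their
   images under the reflection x |-> 18n-1-x, these triangles for i < n use each
   label in 0..18n-1 once. *)
Definition triangles (n i : nat) : seq (seq int) :=
  let n := n%:Z in let i := i%:Z in
  [:: [:: 9 * n + i; 5 * n + 2 * i; 13 * n + 3 * i + 1];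
      [:: 10 * n + i; 2 * n + 3 * i; 18 * n - 1 - i];
      [:: 11 * n + 2 * i; 13 * n + 3 * i; n + i]].

(** Each of the nine distances to the centre, and of the nine absolute differences, is an arithmetic
    progression in [i]. The progressions are disjoint by range, by parity or, for some of the
    distances, by residue modulo 3. The smallest absolute difference is 2n. *)
Lemma labelable_triangles n F :
    (forall d, d \in F -> `|d| < (2 * n)%:Z) ->
  labelable (nseq (6 * n) 3) F.
Proof.
move=> boundF; pose cs := flatten (map (triangles n) (iota 0 n)).
have szcs : map size cs = nseq (3 * n) 3%N.
  rewrite /cs -[in RHS](size_iota 0 n).
  elim: (iota 0 n) => // i s IHs.
  by rewrite [size _]/= mulnS nseqD -IHs.
have sumcs : (sumn (map size cs)).*2 = (18 * n)%N by rewrite szcs sumn_nseq; lia.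
apply: (@labelable_mirror cs); rewrite ?sumcs.
- rewrite szcs -nseqD (_ : 3 * n + 3 * n = 6 * n)%N //; lia.
- rewrite labels_flatten -map_comp; apply/allP => x /flatten_mapP[i].
  by rewrite mem_iota /= !inE => ?; do ?[case/orP]; move=> /eqP -> /=; lia.
- rewrite labels_flatten map_flatten -!map_comp.
  (* u i lists the distances of the labels to the centre, rounded down. *)
  pose u i := [:: i; 4 * n - 1 - 2 * i; 4 * n + 1 + 3 * i;
    n + i; 7 * n - 1 - 3 * i; 9 * n - 1 - i;
    2 * n + 2 * i; 4 * n + 3 * i; 8 * n - 1 - i]%N.
  rewrite [map _ _](_ : _ = map (map (fun x => x.*2.+1)) (map u (iota 0 n))).
    rewrite -map_flatten map_inj_uniq; last by move=> ? ?; lia.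
    apply: uniq_flatten_map; first exact: iota_uniq.
      by move=> i; rewrite mem_iota /= !inE !negb_or => ?; do ?[apply/andP; split]; lia.
    move=> i j x; rewrite !mem_iota !inE => ? ?.
    by do ?[case/orP]; move=> /eqP ->; do ?[case/orP]; move=> /eqP; lia.
  rewrite -map_comp; apply/eq_in_map => i; rewrite mem_iota => ?.
  rewrite /comp /labels /=; do ?[congr cons]; lia.
- rewrite arc_labels_flatten -map_comp; apply/flatten_mapP => -[i].
  by rewrite mem_iota !inE => ?; do ?[case/orP]; move=> /eqP /=; lia.
- rewrite arc_labels_flatten -map_comp.
  (* Here [u i] lists the absolute values of the differences. *)
  pose u i := [:: 4 * n - i; 8 * n + 1 + i; 4 * n + 1 + 2 * i;
    8 * n - 2 * i; 16 * n - 1 - 4 * i; 8 * n - 1 - 2 * i;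
    2 * n + i; 12 * n + 2 * i; 10 * n + i]%N.
  rewrite map_flatten -map_comp (_ : map _ _ = map u (iota 0 n)); last first.
    apply/eq_in_map => i; rewrite mem_iota => ?.
    rewrite /comp /arc_labels /=; do ?[congr cons]; lia.
  apply: uniq_flatten_map; first exact: iota_uniq.
    by move=> i; rewrite mem_iota /= !inE !negb_or => ?; do ?[apply/andP; split]; lia.
  move=> i j x; rewrite !mem_iota !inE => ? ?.
  by do ?[case/orP]; move=> /eqP ->; do ?[case/orP]; move=> /eqP; lia.
- rewrite arc_labels_flatten -map_comp; apply/allP => d /flatten_mapP[i].
  rewrite mem_iota => iP dP; have dn : (2 * n)%:Z <= `|d|.
    by move: dP; rewrite !inE; do ?[case/orP]; move=> /eqP -> /=; lia.
  by apply/andP; split; apply/negP => /boundF; lia.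
Qed.

(** * Explicit labellings of small inner parts *)

Definition labels_ok (ks : seq nat) (F : seq int) (cs : seq (seq int)) : bool :=
  [&& perm_eq (map size cs) ks,
      all (fun x => 0 <= x < (sumn ks)%:Z) (labels cs),
      uniq (labels cs), uniq (arc_labels cs) & ~~ has (mem F) (arc_labels cs)].

(** Reduces a concrete labelling to a boolean computation. *)
Lemma labels_ok_labelable ks F cs : labels_ok ks F cs -> labelable ks F.
Proof. by move=> /and5P[]; exists cs. Qed.

Lemma labelable_4 : labelable [:: 4] [::].
Proof. exact: (@labels_ok_labelable _ _ [:: [:: 0; 1; 3; 2]]). Qed.

Lemma labelable_43 : labelable [:: 4; 3] [::].
Proof. exact: (@labels_ok_labelable _ _ [:: [:: 0; 5; 3; 6]; [:: 1; 2; 4]]). Qed.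

Lemma labelable_443 : labelable [:: 4; 4; 3] [::].
Proof.
exact: (@labels_ok_labelable _ _ [:: [:: 6; 3; 9; 1]; [:: 5; 7; 0; 4]; [:: 2; 10; 8]]).
Qed.

Lemma labelable_223 : labelable [:: 2; 2; 3] [::].
Proof. exact: (@labels_ok_labelable _ _ [:: [:: 2; 4]; [:: 3; 6]; [:: 0; 5; 1]]). Qed.

(** Lengths 5 and 7 are too short for [labelable_odd] to leave 1 and -2 free, so an unpaired C_4 is
    labelled jointly with them. *)
Lemma labelable_45 : labelable [:: 4; 5] [::].
Proof. exact: (@labels_ok_labelable _ _ [:: [:: 0; 4; 5; 3]; [:: 1; 8; 2; 7; 6]]). Qed.

Lemma labelable_47 : labelable [:: 4; 7] [::].
Proof.
exact: (@labels_ok_labelable _ _ [:: [:: 0; 5; 8; 7]; [:: 10; 4; 2; 6; 1; 3; 9]]).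
Qed.

Lemma labelable_33 : labelable [:: 3; 3] [::].
Proof. exact: (@labels_ok_labelable _ _ [:: [:: 0; 1; 3]; [:: 2; 5; 4]]). Qed.

Lemma labelable_433 : labelable [:: 4; 3; 3] [::].
Proof. exact: (@labels_ok_labelable _ _ [:: [:: 7; 0; 6; 4]; [:: 1; 5; 2]; [:: 3; 8; 9]]). Qed.

Lemma labelable_333 : labelable [:: 3; 3; 3] [::].
Proof. exact: (@labels_ok_labelable _ _ [:: [:: 0; 7; 2]; [:: 1; 5; 8]; [:: 3; 4; 6]]). Qed.

Lemma labelable_4333 : labelable [:: 4; 3; 3; 3] [::].
Proof.
exact: (@labels_ok_labelable _ _
  [:: [:: 8; 9; 7; 2]; [:: 0; 10; 12]; [:: 1; 5; 4]; [:: 3; 6; 11]]).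
Qed.

(** The differences 1 and -2 are kept for the short arcs of a C_4, see [labelable_4_layer]. *)
Lemma labelable_four_triangles : labelable (nseq 4 3) [:: 1; -2].
Proof.
exact: (@labels_ok_labelable _ _
  [:: [:: 0; 7; 10]; [:: 1; 6; 8]; [:: 2; 11; 5]; [:: 3; 9; 4]]).
Qed.

Lemma labelable_five_triangles : labelable (nseq 5 3) [:: 1; -2].
Proof.
exact: (@labels_ok_labelable _ _
  [:: [:: 0; 6; 5]; [:: 1; 10; 12]; [:: 2; 7; 14]; [:: 3; 13; 9]; [:: 4; 8; 11]]).
Qed.

(** Besides 1 and -2, the value -1 is kept for one extra triangle; the longer lists for eight and
    twelve triangles allow up to four and five. *)
Lemma labelable_six_triangles : labelable (nseq 6 3) [:: 1; -1; -2].
Proof.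
exact: (@labels_ok_labelable _ _
  [:: [:: 0; 16; 6]; [:: 17; 2; 11]; [:: 1; 5; 13]; [:: 15; 8; 3];
      [:: 4; 9; 12]; [:: 14; 10; 7]]).
Qed.

Lemma labelable_eight_triangles :
  labelable (nseq 8 3) [:: 1; -2; -1; 2; 3; -3].
Proof.
exact: (@labelable_mirror
  [:: [:: 23; 9; 1]; [:: 21; 15; 4]; [:: 20; 11; 7]; [:: 18; 13; 6]]).
Qed.

Lemma labelable_twelve_triangles :
  labelable (nseq 12 3) [:: 1; -2; -1; 2; 3; -3; 4].
Proof.
exact: (@labelable_mirror
  [:: [:: 35; 21; 26]; [:: 34; 19; 8]; [:: 33; 20; 3]; [:: 31; 24; 6];
      [:: 30; 22; 10]; [:: 28; 18; 12]]).
Qed.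

(** * Extra triangles around a family of triangles *)

Definition extra_triangles (e : nat) : seq (seq (int * int)) :=
  match e with
  | 1 => [:: [:: (0, 0); (1, 1); (1, 0)]]
  | 2 => [:: [:: (0, 0); (1, 0); (1, 3)]; [:: (0, 1); (1, 2); (1, 1)]]
  | 3 => [:: [:: (0, 0); (0, 2); (1, 0)]; [:: (0, 1); (1, 3); (1, 2)];
             [:: (0, 3); (1, 4); (1, 1)]]
  | 4 => [:: [:: (0, 0); (0, 2); (1, 2)]; [:: (0, 1); (1, 6); (1, 5)];
             [:: (0, 3); (1, 1); (1, 4)]; [:: (0, 4); (1, 3); (1, 0)]]
  | 5 => [:: [:: (0, 0); (1, 0); (1, 2)]; [:: (0, 1); (1, 3); (1, 6)];
             [:: (0, 2); (1, 1); (1, 5)]; [:: (0, 3); (1, 7); (1, 4)];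
             [:: (0, 4); (1, 9); (1, 8)]]
  | _ => [::]
  end.

(** Each extra triangle has exactly one short arc. The set in [layer_ok] may exceed the short
    differences that occur, so the list for four triangles also serves two and three. *)
Definition extra_steps (e : nat) : seq int :=
  match e with
  | 0 => [::]
  | 1 => [:: -1]
  | 5 => [:: -1; 2; 3; -3; 4]
  | _ => [:: -1; 2; 3; -3]
  end.

Lemma labelable_extra_triangles e m : (e <= 5)%N -> (1 < m)%N ->
    labelable (nseq m 3) ([:: 1; -2] ++ extra_steps e) ->
  labelable (nseq (e + m) 3) [:: 1; -2].
Proof.
move=> e5 m2 mlab; rewrite nseqD.
(* The witnesses count the low and the high labels of each pattern. *)
have [p [r ok]] : exists p r,
    layer_ok (extra_triangles e) p r (extra_steps e) [:: 1; -2].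
  case: e e5 {mlab} => [|[|[|[|[|[|]]]]]] // _; [exists 0, 0 | exists 1, 2
    | exists 2, 4 | exists 4, 5 | exists 5, 7 | exists 5, 10]; by vm_compute.
have -> : nseq e 3%N = map size (extra_triangles e).
  by case: e e5 {mlab ok} => [|[|[|[|[|[|]]]]]].
apply: (labelable_layer ok mlab).
- by move=> d dS; rewrite mem_cat dS orbT.
- by move=> d dS; rewrite mem_cat dS.
(* Reserved differences have absolute value at most 4, and the inner part has at least six
   labels. *)
- move=> d; rewrite sumn_nseq => dF; have : `|d| <= 4; last by lia.
  by apply: (allP (_ : all (fun d => `|d| <= 4) _)) dF;
    case: e e5 {mlab ok} => [|[|[|[|[|[|]]]]]].
Qed.

(** The family of 6n triangles avoids every absolute value below 2n. Reserved differences reach 4,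
    so it is used for n at least 3, with the remainder modulo 6 wrapped around; below 18, explicit
    labellings start the construction. *)
Lemma labelable_many_triangles m : (3 < m)%N -> labelable (nseq m 3) [:: 1; -2].
Proof.
move=> m4.
have six e : (e <= 1)%N -> labelable (nseq (e + 6) 3) [:: 1; -2].
  move=> e1; apply: labelable_extra_triangles => //; first by lia.
  by apply: labelable_sub labelable_six_triangles; apply/allP; case: e e1 => [|[|]].
have eight e : (e <= 4)%N -> labelable (nseq (e + 8) 3) [:: 1; -2].
  move=> e4; apply: labelable_extra_triangles => //; first by lia.
  apply: labelable_sub labelable_eight_triangles; apply/allP.
  by case: e e4 => [|[|[|[|[|]]]]].
have twelve e : (e <= 5)%N -> labelable (nseq (e + 12) 3) [:: 1; -2].
  move=> e4; apply: labelable_extra_triangles => //.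
  apply: labelable_sub labelable_twelve_triangles; apply/allP.
  by case: e e4 => [|[|[|[|[|[|]]]]]].
case: (ltnP m 6) => m6.
  have [->|->] : m = 4%N \/ m = 5%N by lia.
    exact: labelable_four_triangles.
  exact: labelable_five_triangles.
case: (ltnP m 8) => m8; first by rewrite -(subnK m6); apply: six; lia.
case: (ltnP m 12) => m12; first by rewrite -(subnK m8); apply: eight; lia.
case: (ltnP m 18) => m18; first by rewrite -(subnK m12); apply: twelve; lia.
rewrite (divn_eq m 6) addnC mulnC; have m6lt := ltn_pmod m (isT : 0 < 6)%N.
apply: labelable_extra_triangles; [by lia|by lia|].
apply: labelable_triangles => d dF; have : `|d| <= 4; last by lia.
by apply: (allP (_ : all (fun d => `|d| <= 4) _)) dF;
  case: (m %% 6)%N m6lt => [|[|[|[|[|[|]]]]]].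
Qed.

(** * Wrapping the even circuits around the inner part *)

Lemma labelable_2_layer ks : labelable ks [::] -> labelable (2 :: ks) [::].
Proof.
move=> kslab.
by apply: (@labelable_layer [:: [:: (0, 0); (1, 0)]] 1 1 [::] [::] [::]).
Qed.

(** A single alternating C_4 with two consecutive labels at each end repeats a difference, both gaps
    being 1. Two such circuits can share the ends with gap 1 among low labels and gap 2 among high
    ones. *)
Lemma labelable_44_layer ks : labelable ks [::] -> labelable [:: 4, 4 & ks] [::].
Proof.
move=> kslab.
by apply: (@labelable_layer [:: [:: (0, 0); (1, 3); (0, 1); (1, 1)];
  [:: (0, 2); (1, 0); (0, 3); (1, 2)]] 4 4 [::] [::] [::]).
Qed.

Lemma labelable_4_layer ks : (1 < sumn ks)%N ->
  labelable ks [:: 1; -2] -> labelable (4 :: ks) [::].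
Proof.
move=> ks2 kslab.
apply: (@labelable_layer [:: [:: (0, 1); (0, 2); (0, 0); (1, 0)]] 3 1
  [:: 1; -2] [:: 1; -2] [::]) => // d.
by rewrite !inE => /orP[] /eqP ->; lia.
Qed.

Lemma labelable_3_layer ks : (0 < sumn ks)%N ->
  labelable ks [:: -1] -> labelable (3 :: ks) [::].
Proof.
move=> ks2 kslab.
apply: (@labelable_layer [:: [:: (0, 0); (1, 1); (1, 0)]] 1 2 [:: -1] [:: -1] [::])
  => // d.
by rewrite !inE => /eqP ->; lia.
Qed.

(** Circuits C_4 are wrapped in pairs, the others one by one. *)
Lemma labelable_evens (es ks : seq nat) :
    (forall k, k \in es -> (1 < k)%N && ~~ odd k) -> ~~ odd (count_mem 4%N es) ->
  labelable ks [::] -> labelable (es ++ ks) [::].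
Proof.
(* Induction on a bound for the size, since a pair of C_4 removes two entries. *)
elim: (size es) {-2}es (leqnn (size es)) => [|n IHn] {}es.
  by rewrite leqn0 size_eq0 => /eqP ->.
case: es => [|k es] //= sz_es es_even es4 kslab.
have [k1 ke] := andP (es_even k (mem_head _ _)).
have es_even' l : l \in es -> (1 < l)%N && ~~ odd l.
  by move=> les; apply: es_even; rewrite inE les orbT.
have [k4|k_ne4] := eqVneq k 4%N.
  subst k; have es_4 : 4%N \in es.
    by rewrite -has_pred1 has_count; move: es4; rewrite /=; case: count.
  apply: (@labelable_perm [:: 4, 4 & rem 4%N es ++ ks]%N).
    by rewrite perm_cons -cat_cons perm_cat2r perm_sym perm_to_rem.
  apply: labelable_44_layer; apply: IHn => //.
  - by rewrite size_rem //; apply: leq_trans (leq_pred _) _.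
  - by move=> l /mem_rem /es_even'.
  - by move: es4; rewrite (permP (perm_to_rem es_4)) /= negbK.
have lab : labelable (es ++ ks) [::].
  by apply: IHn => //; move: es4; rewrite /= (negbTE k_ne4).
case: (ltnP 2 k) => k2; last first.
  by rewrite (_ : k = 2%N); [apply: labelable_2_layer|lia].
by rewrite (_ : k = k./2.*2); [apply: labelable_even_layer => //; lia|lia].
Qed.

(** When the number of C_4 is odd, the unpaired one joins the inner part. *)
Lemma labelable_evens_or_4 (es ks : seq nat) :
    (forall k, k \in es -> (1 < k)%N && ~~ odd k) ->
    labelable ks [::] -> labelable (4%N :: ks) [::] ->
  labelable (es ++ ks) [::].
Proof.
move=> es_even kslab ks4lab.
case: (boolP (odd (count_mem 4%N es))) => es4; last exact: labelable_evens.
have es_4 : 4%N \in es by rewrite -has_pred1 has_count; case: count es4.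
apply: (@labelable_perm (rem 4%N es ++ 4%N :: ks)).
  rewrite -cat1s catA perm_cat2r perm_catC perm_sym;
      exact: perm_to_rem.
apply: labelable_evens => //; first by move=> l /mem_rem /es_even.
by move: es4; rewrite (permP (perm_to_rem es_4)) /=.
Qed.

Lemma labelable_nil : labelable [::] [::].
Proof. by exists [::]. Qed.

Lemma labelable_evens_odd (es : seq nat) n :
    (forall k, k \in es -> (1 < k)%N && ~~ odd k) -> odd n -> (3 < n)%N ->
  labelable (es ++ [:: n]) [::].
Proof.
move=> es_even n_odd n3; have nE : n = n./2.*2.+1 by lia.
apply: labelable_evens_or_4 => //.
  by rewrite nE; apply: labelable_odd; [lia|left].
case: (ltnP n 9) => n9; last first.
  apply: labelable_4_layer; first by rewrite /=; lia.
  by rewrite nE; apply: labelable_odd; [lia|right; split=> //; lia].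
have [->|->] : n = 5%N \/ n = 7%N by lia.
  exact: labelable_45.
exact: labelable_47.
Qed.

Lemma labelable_evens_triangles (es : seq nat) m :
    (forall k, k \in es -> (1 < k)%N && ~~ odd k) -> (1 < m)%N ->
  labelable (es ++ nseq m 3) [::].
Proof.
move=> es_even m1; case: (ltnP 3 m) => m3.
  have mlab := labelable_many_triangles m3.
  apply: labelable_evens_or_4 => //; first exact: labelable_sub mlab.
  by apply: labelable_4_layer => //; rewrite sumn_nseq; lia.
have [->|->] : m = 2%N \/ m = 3%N by lia.
  exact: labelable_evens_or_4 labelable_33 labelable_433.
exact: labelable_evens_or_4 labelable_333 labelable_4333.
Qed.

(** C_3 alone has no gdl, so the innermost part must involve an even circuit: one C_4 or two
    according to parity, two C_2 if no other length occurs, and otherwise a circuit of length at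
    least 6 with the triangle wrapped around it. *)
Lemma labelable_evens_3 (es : seq nat) :
    (forall k, k \in es -> (1 < k)%N && ~~ odd k) -> es <> [::] -> es <> [:: 2%N] ->
  labelable (es ++ [:: 3]) [::].
Proof.
move=> es_even es_ne0 es_ne2.
have rem_even k l : l \in rem k es -> (1 < l)%N && ~~ odd l by move=> /mem_rem /es_even.
case: (boolP (odd (count_mem 4%N es))) => es4.
  have es_4 : 4%N \in es by rewrite -has_pred1 has_count; case: count es4.
  apply: (@labelable_perm (rem 4%N es ++ [:: 4; 3]%N)).
    by rewrite -[[:: 4; 3]%N]cat1s catA perm_cat2r perm_catC perm_sym;
      exact: perm_to_rem.
  apply: labelable_evens labelable_43 => //; first exact: rem_even.
  by move: es4; rewrite (permP (perm_to_rem es_4)) /=.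
case: (boolP (4%N \in es)) => es_4.
  (* An even positive number of C_4: removing one leaves an odd number, hence a second one. *)
  have rem4 : odd (count_mem 4%N (rem 4%N es)).
    by move: es4; rewrite (permP (perm_to_rem es_4)) /= negbK.
  apply: (@labelable_perm (rem 4%N es ++ [:: 4; 3]%N)).
    by rewrite -[[:: 4; 3]%N]cat1s catA perm_cat2r perm_catC perm_sym;
      exact: perm_to_rem.
  have rem_4 : 4%N \in rem 4%N es by rewrite -has_pred1 has_count; case: count rem4.
  apply: (@labelable_perm (rem 4%N (rem 4%N es) ++ [:: 4; 4; 3]%N)).
    by rewrite -[[:: 4; 4; 3]%N]cat1s catA perm_cat2r perm_catC perm_sym;
      exact: perm_to_rem.
  apply: labelable_evens labelable_443 => //; first by move=> l /mem_rem /rem_even.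
  by move: rem4; rewrite (permP (perm_to_rem rem_4)) /=.
case: (boolP (all (pred1 2%N) es)) => [/all_pred1P esE|].
  move: es_ne0 es_ne2; rewrite esE; case: (size es) => [|[|n]] // _ _.
  apply: (@labelable_perm (nseq n 2%N ++ [:: 2; 2; 3]%N)).
    by rewrite perm_catC /= !perm_cons perm_sym perm_catC.
  apply: labelable_evens labelable_223 => [k|].
    by rewrite mem_nseq => /andP[_ /eqP ->].
  by rewrite count_nseq.
move=> /allPn[k kes /= k_ne2].
have [k1 ke] := andP (es_even k kes).
have k_ne4 : k != 4%N by apply: contraNneq es_4 => <-.
apply: (@labelable_perm (rem k es ++ [:: k; 3]%N)).
  by rewrite -[[:: k; 3]%N]cat1s catA perm_cat2r perm_catC perm_sym;
      exact: perm_to_rem.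
apply: labelable_evens; first exact: rem_even.
  by move: es4; rewrite (permP (perm_to_rem kes)) /= (negbTE k_ne4).
apply: (@labelable_perm [:: 3; k]%N); first by rewrite (perm_catC [:: _] [:: _]).
rewrite (_ : k = k./2.*2); last by lia.
apply: labelable_3_layer; first by rewrite /=; lia.
by apply: labelable_even; lia.
Qed.

(** * Isomorphisms of disjoint unions and the final case distinction *)

Lemma isomorphic_trans (G H K : digraph) :
  isomorphic G H -> isomorphic H K -> isomorphic G K.
Proof.
move=> [g gB gA] [h hB hA]; exists (h \o g); first exact: bij_comp.
by move=> u v /=; rewrite hA gA.
Qed.

Lemma isomorphic_djunion_empty (G : digraph) : isomorphic (djunion G empty_digraph) G.
Proof.
exists (fun x : djunion G empty_digraph =>
  match x with inl u => u | inr v => match v with end end).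
  by exists inl => [[u|[]]|u].
by move=> [u|[]] [v|[]].
Qed.

Lemma isomorphic_djunion (G G' H H' : digraph) :
  isomorphic G G' -> isomorphic H H' -> isomorphic (djunion G H) (djunion G' H').
Proof.
move=> [g [g' gK g'K] gA] [h [h' hK h'K] hA].
exists (fun x : djunion G H => match x with inl u => inl (g u) | inr v => inr (h v) end).
  exists (fun x => match x with inl u => inl (g' u) | inr v => inr (h' v) end).
    by move=> [u|v]; rewrite ?gK ?hK.
  by move=> [u|v]; rewrite ?g'K ?h'K.
by move=> [u|u] [v|v] //=; rewrite ?gA ?hA.
Qed.

Lemma isomorphic_djunionC (G H : digraph) : isomorphic (djunion G H) (djunion H G).
Proof.
exists (fun x : djunion G H => match x with inl u => inr u | inr v => inl v end).
  by exists (fun x => match x with inl u => inr u | inr v => inl v end) => -[].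
by move=> [u|u] [v|v].
Qed.

Lemma isomorphic_refl (G : digraph) : isomorphic G G.
Proof. by exists id => //; exists id. Qed.

Local Close Scope ring_scope.

Theorem theorem9 (G : digraph) (ks : seq nat)
    (Hlen : forall k : nat, k \in ks -> 2 <= k)
    (HG : isomorphic G (circuits ks))
    (Hodd : count odd ks <= 1 \/ (forall k : nat, k \in ks -> odd k -> k = 3))
    (HnC3 : ~ isomorphic G (circuit 3))
    (HnC2C3 : ~ isomorphic G (djunion (circuit 2) (circuit 3))) :
  has_gdl G.
Proof.
apply: (@labelable_has_gdl _ _ [::] HG).
set os := filter odd ks; set es := filter (predC odd) ks.
have pks : perm_eq (es ++ os) ks by rewrite perm_catC perm_filterC.
apply: (labelable_perm pks).
have es_even (k : nat) : k \in es -> (1 < k) && ~~ odd k.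
  by rewrite mem_filter => /andP[/= -> /Hlen ->].
have os_odd (k : nat) : k \in os -> odd k /\ 1 < k.
  by rewrite mem_filter => /andP[/= -> /Hlen ->].
(* The two excluded graphs are exactly those with [es] equal to [[::]] or [[:: 2]] here. *)
have three : os = [:: 3] -> labelable (es ++ os) [::].
  move=> os3; move: pks; rewrite os3 => pks; apply: labelable_evens_3 => // esE.
    move: pks; rewrite esE perm_sym => /(@perm_small_eq _ _ [:: 3] isT) ksE.
    apply: HnC3; move: HG; rewrite ksE => HG'.
    exact: isomorphic_trans HG' (isomorphic_djunion_empty _).
  apply: HnC2C3; move: pks; rewrite esE perm_sym => pks.
  (* The list [ks] is known only up to order; the second order needs commutativity of the disjoint
     union. *)
  have [kE|kE] : ks = [:: 2; 3] \/ ks = [:: 3; 2].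
    have := perm_size pks; case: (ks) pks => [|a [|b []]] // pks _.
    have a23 : a \in [:: 2; 3] by rewrite -(perm_mem pks) mem_head.
    have := perm_sumn pks; move: a23; rewrite !inE /= => /orP[] /eqP -> ?.
      by left; congr [:: _; _]; lia.
    by right; congr [:: _; _]; lia.
  - move: HG; rewrite kE /= => HG'; apply: isomorphic_trans HG' _.
    apply: isomorphic_djunion; first exact: isomorphic_refl.
    exact: isomorphic_djunion_empty.
  - move: HG; rewrite kE /= => HG'; apply: isomorphic_trans HG' _.
    apply: isomorphic_trans (isomorphic_djunionC _ _) _.
    apply: isomorphic_djunion; last exact: isomorphic_refl.
    exact: isomorphic_djunion_empty.
have empty : os = [::] -> labelable (es ++ os) [::].
  by move=> ->; apply: labelable_evens_or_4 labelable_nil labelable_4.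
case: Hodd => [le1|all3].
  have : size os <= 1 by rewrite size_filter.
  case: os os_odd three empty {pks le1} => [|n []] // os_odd three empty _.
    exact: empty.
  have [n_odd n1] := os_odd n (mem_head _ _).
  have [n3|n_ne3] := eqVneq n 3; first by apply: three; rewrite n3.
  by apply: labelable_evens_odd => //; lia.
have osE : os = nseq (size os) 3.
  apply/all_pred1P/allP => k; rewrite mem_filter => /andP[ko kks].
  by rewrite /= (all3 k kks ko).
move: three empty; rewrite osE; case: (size os) => [|[|m]] three empty.
- exact: empty.
- exact: three.
- exact: labelable_evens_triangles.
Qed.
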